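(* Let $P$ be the set of all integer partitions and $D$ the set of partitions into distinct parts (each including the empty partition of $0$). Define $P^*_1:=\{\pi\in D:\#(\pi)\not\equiv 2 \pmod 3\}$, $P_2:=\{\pi\in P: \text{no part of }\pi\text{ is divisible by }3\}$, and $P^*_3:=\{\pi\in P:\#(\pi)\not\equiv 1\pmod 3\}$. For a partition $\pi$ let $\sigma^*(\pi)=1$ if $\#(\pi)\equiv 0\pmod 3$ and $\sigma^*(\pi)=0$ otherwise, and let $\mu^*(\pi):=\#(\pi)+\sigma^*(\pi)$. Then, as formal power series in $q$, \[ \sum_{\pi\in P^*_1}(-1)^{\mu^*(\pi)}q^{|\pi|}=\sum_{(\pi_1,\pi_2)\in P_2\times P^*_3}(-1)^{\sigma^*(\pi_2)}q^{|\pi_1|+|\pi_2|}. \]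
   Context: A partition of a non-negative integer $n$ is a non-increasing finite sequence of positive integers summing to $n$; the empty sequence is the unique partition of $0$. For a partition $\pi$, $|\pi|$ denotes the sum of its parts and $\#(\pi)$ its number of parts. *)

(* Defs.v *)
From HB Require Import structures.
From mathcomp Require Import all_boot all_order all_algebra.
From mathcomp Require Import boolp classical_sets functions cardinality fsbigop.

Set Implicit Arguments.
Unset Strict Implicit.
Unset Printing Implicit Defensive.

Import GRing.Theory.

Local Open Scope ring_scope.
Local Open Scope classical_set_scope.

Definition is_intpart (s : seq nat) : bool := sorted geq s && (0 \notin s)%N.

Record intpart := IntPart {
  parts :> seq nat;
  partsP : is_intpart parts
}.

HB.instance Definition _ := [isSub for parts].
HB.instance Definition _ := [Choice of intpart by <:].

Definition psum (p : intpart) : nat := sumn (parts p).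
Definition nparts (p : intpart) : nat := size (parts p).

Definition Pset : set intpart := setT.
Definition Dset : set intpart := [set p | uniq (parts p)].

Definition P1star : set intpart := [set p | Dset p /\ nparts p <> 2 %[mod 3]].
Definition P2 : set intpart :=
  [set p | Pset p /\ forall k : nat, k \in parts p -> ~~ (3 %| k)%N].
Definition P3star : set intpart := [set p | Pset p /\ nparts p <> 1 %[mod 3]].

Definition sigma_star (p : intpart) : nat :=
  if nparts p == 0 %[mod 3] then 1%N else 0%N.
Definition mu_star (p : intpart) : nat := (nparts p + sigma_star p)%N.

(* A formal power series in q over int is its sequence of coefficients. *)
Definition fps : Type := nat -> int.

(* The series \sum_(x in A) c x * q ^ w x. The sum in each coefficient is the
   library's finitely supported one, which is 0 by convention when the support
   is infinite; finite_psum and finite_psum2 show that the case does not arise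
   for the weights psum p and psum p.1 + psum p.2. *)
Definition genfun (T : choiceType) (A : set T) (c : T -> int) (w : T -> nat)
  : fps :=
  fun n => \sum_(x \in [set x | A x /\ w x = n]) c x.

Lemma finite_bounded_seq (m k : nat) :
  finite_set [set s : seq nat | (size s <= k)%N /\ all (fun i => i < m)%N s].
Proof.
elim: k => [|k IHk].
  apply: (@sub_finite_set _ _ [set [::]]); last exact: finite_set1.
  by move=> s [/=]; rewrite leqn0 size_eq0 => /eqP.
apply: (@sub_finite_set _ _ ([set [::]] `|`
  [set x :: s | x in `I_m & s in
     [set s : seq nat | (size s <= k)%N /\ all (fun i => i < m)%N s]])).
  move=> [|x s] [/= szs]; first by left.
  by move=> /andP[xm sm]; right; exists x => //; exists s.
rewrite finite_setU; split; first exact: finite_set1.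
exact: finite_image2 (finite_II m) IHk.
Qed.

Lemma finite_psum (n : nat) : finite_set [set p | psum p = n].
Proof.
apply: (@sub_finite_set _ _ (parts @^-1`
  [set s : seq nat | (size s <= n)%N /\ all (fun i => i < n.+1)%N s])).
  move=> [s sP]; rewrite /psum /= => <-; case/andP: sP => _ s0; split.
    elim: s s0 => //= x s IHs; rewrite inE negb_or eq_sym -lt0n => /andP[x0 s0].
    by rewrite -add1n leq_add // IHs.
  elim: s {s0} => //= x s IHs; rewrite ltnS leq_addr /=.
  by apply: sub_all IHs => i; rewrite !ltnS => /leq_trans; apply; apply: leq_addl.
apply: finite_preimage; last exact: finite_bounded_seq.
by move=> p q _ _; apply: val_inj.
Qed.

Lemma finite_psum2 (n : nat) :
  finite_set [set x : intpart * intpart | (psum x.1 + psum x.2)%N = n].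
Proof.
pose B := [set p | (psum p <= n)%N].
have finB : finite_set B.
  apply: (@sub_finite_set _ _ (\bigcup_(i in `I_n.+1) [set p | psum p = i])).
    by move=> p pn; exists (psum p).
  by apply: bigcup_finite => [|i _]; [apply: finite_II | apply: finite_psum].
apply: (@sub_finite_set _ _ (B `*` B)); last exact: finite_setX.
by move=> [p q] /=; rewrite /B => <-; split; rewrite /= ?leq_addr ?leq_addl.
Qed.

(* Main.v *)
Require Import Defs.
From mathcomp Require Import all_boot all_order all_algebra all_field.
From mathcomp Require Import ring zify.
From mathcomp Require Import boolp classical_sets functions cardinality fsbigop.

(* Let w be a primitive cube root of unity. The sign weights on both sides are
   combinations of w^k and w^(2k), where k is the number of parts, so the two
   series are the same combination of Euler products: with
   D(z) = prod_i (1 - z q^i), the left side only involves D(w) and D(w^2), and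
   the right side only G/D(w^2) and G/D(w), where G is the generating function
   of P2. The theorem thus follows from D(w) D(w^2) = G, which holds because
   (1 - w y)(1 - w^2 y) = (1 - y^3)/(1 - y). The coefficient of q^n is computed
   in the ring of polynomials modulo q^(n+1), where q is nilpotent. *)

Set Implicit Arguments.
Unset Strict Implicit.
Unset Printing Implicit Defensive.

Import GRing.Theory.

Local Open Scope ring_scope.
Local Open Scope classical_set_scope.

(** * Truncated Euler products at a nilpotent element *)

Section NilpotentProducts.
Variables (S : comNzRingType) (n : nat) (x : S).
Hypothesis xn0 : x ^+ n.+1 = 0.

Definition euler_prod (P : pred nat) (z : S) :=
  \prod_(i < n | P i.+1) (1 - z * x ^+ i.+1).
Definition geom_prod (P : pred nat) (z : S) :=
  \prod_(i < n | P i.+1) \sum_(j < n.+1) (z * x ^+ i.+1) ^+ j.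

Lemma nilp_exp_ge k : (n < k)%N -> x ^+ k = 0.
Proof. by move=> nk; rewrite -(subnK nk) exprD xn0 mulr0. Qed.

(** Each pair of factors telescopes to [1 - (z * x ^+ i.+1) ^+ n.+1], where the exponent of [x]
    exceeds [n]. *)
Lemma euler_geom P z : euler_prod P z * geom_prod P z = 1.
Proof.
rewrite /euler_prod /geom_prod -big_split /= big1 // => i _.
rewrite -opprB mulNr -subrX1 exprMn -exprM nilp_exp_ge; last by nia.
by rewrite mulr0 sub0r opprK.
Qed.

Lemma prod_multiples3 (F : nat -> S) m :
  \prod_(0 <= k < 3 * m | (3 %| k.+1)%N) F k.+1 = \prod_(i < m) F (3 * i.+1)%N.
Proof.
elim: m => [|m IHm]; first by rewrite muln0 big_nil big_ord0.
rewrite big_ord_recr -IHm /= (_ : (3 * m.+1 = (3 * m).+3)%N); last by lia.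
rewrite big_mkcond !(@big_nat_recr _ _ _ _ 0) //= -big_mkcond /=.
rewrite ifF; last by lia.
rewrite ifF; last by lia.
by rewrite ifT ?mulr1 //; lia.
Qed.

(** The exponents [3 * i.+1] run over the multiples of 3 up to [3 * n]; those beyond [n] give
    factors equal to 1. *)
Lemma prod_cubes :
  \prod_(i < n) (1 - (x ^+ i.+1) ^+ 3) = euler_prod (fun k => 3 %| k)%N 1.
Proof.
transitivity (\prod_(i < n) (1 - x ^+ (3 * i.+1))).
  by apply: eq_bigr => i _; rewrite -exprM mulnC.
rewrite -(prod_multiples3 (fun k => 1 - x ^+ k)).
rewrite (@big_cat_nat _ _ _ n) //=; last by lia.
rewrite [X in _ * X]big_nat_cond [X in _ * X]big1 ?mulr1; last first.
  by move=> i /andP[/andP[ni _] _]; rewrite nilp_exp_ge ?subr0.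
by rewrite big_mkord; apply: eq_bigr => i _; rewrite mul1r.
Qed.

(* Factorwise, (1 - w y)(1 - w^2 y)(1 - y) = 1 - y^3 with y = x^i, and the
   cubes with 3 i > n vanish. *)
Lemma euler_omega (w : S) : w ^+ 2 + w + 1 = 0 ->
  euler_prod predT w
  = geom_prod (fun k => ~~ (3 %| k)%N) 1 * geom_prod predT (w ^+ 2).
Proof.
move=> w2; set Q := fun k : nat => ~~ (3 %| k)%N.
have cube : euler_prod predT w * euler_prod predT (w ^+ 2) * euler_prod predT 1
    = euler_prod (fun k => 3 %| k)%N 1.
  rewrite -prod_cubes /euler_prod -!big_split /=; apply: eq_bigr => i _.
  have -> : w ^+ 2 = - w - 1.
    by apply/eqP; rewrite -subr_eq0 -w2; apply/eqP; ring.
  set y := x ^+ i.+1.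
  (* With [w ^+ 2] eliminated on the left, the two sides differ by this multiple of
     [w ^+ 2 + w + 1], so a polynomial identity remains. *)
  transitivity (1 - y ^+ 3 + (w ^+ 2 + w + 1) * (y ^+ 3 - y ^+ 2)); last first.
    by rewrite w2; ring.
  by ring.
have split1 :
    euler_prod predT 1 = euler_prod (fun k => 3 %| k)%N 1 * euler_prod Q 1.
  by rewrite /euler_prod (bigID (fun i : 'I_n => 3 %| i.+1)%N).
have T1 := euler_geom (fun k => 3 %| k)%N 1.
have Q1 := euler_geom Q 1.
have W1 := euler_geom predT (w ^+ 2).
move: cube T1 Q1 W1; rewrite split1.
set a := euler_prod predT w; set b := euler_prod predT _.
set t := euler_prod _ 1; set e := euler_prod Q 1.
set t' := geom_prod _ 1; set e' := geom_prod Q 1; set b' := geom_prod _ _.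
move=> cube T1 Q1 W1.
(* Multiplying [a] by [b * b'], [t * t'] and [e * e'], all equal to 1, brings out the left side of
   [cube]. *)
transitivity (a * (b * (t * e)) * t' * e' * b').
  by transitivity (a * (b * b') * (t * t') * (e * e'));
    [rewrite W1 T1 Q1 !mulr1 | ring].
by rewrite mulrA cube T1 mul1r.
Qed.

End NilpotentProducts.

(** * Passage to polynomials modulo a power of the variable *)

Lemma rmorph_euler_prod (S T : comNzRingType) (phi : {rmorphism S -> T})
    n x P z :
  phi (euler_prod n x P z) = euler_prod n (phi x) P (phi z).
Proof.
rewrite rmorph_prod; apply: eq_bigr => i _.
by rewrite rmorphB rmorph1 rmorphM rmorphXn.
Qed.

Lemma rmorph_geom_prod (S T : comNzRingType) (phi : {rmorphism S -> T})
    n x P z :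
  phi (geom_prod n x P z) = geom_prod n (phi x) P (phi z).
Proof.
rewrite rmorph_prod; apply: eq_bigr => i _.
by rewrite rmorph_sum; apply: eq_bigr => j _; rewrite rmorphXn rmorphM rmorphXn.
Qed.

(** A polynomial differs from its remainder by a multiple of ['X^(n.+1)], which has no term of
    degree [n]. *)
Lemma coef_eq_mod_Xn (R : comNzRingType) n (p q : {poly R}) :
  in_qpoly ('X^(n.+1)) p = in_qpoly ('X^(n.+1)) q -> p`_n = q`_n.
Proof.
move=> /(congr1 val) /=; rewrite mk_monic_Xn /= => pq.
have E (r : {poly R}) : r`_n = (Pdiv.CommonRing.rmodp r ('X^(n.+1)))`_n.
  rewrite {1}(Pdiv.RingMonic.rdivp_eq (monicXn _ n.+1) r).
  by rewrite coefD coefMXn ltnS leqnn add0r.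
by rewrite E pq -E.
Qed.

(** * Encoding of partitions by multiplicities *)

(* A partition with parts at most n is encoded by its multiplicities: f i is
   the multiplicity of the part i.+1. *)
Definition mults n := {ffun 'I_n -> 'I_n.+1}.

Definition mweight n (f : mults n) : nat := (\sum_i f i * i.+1)%N.
Definition msize n (f : mults n) : nat := (\sum_i f i)%N.

(** The blocks are listed by increasing part, while an [intpart] is non-increasing; hence the
    [sort]. *)
Definition mseq n (f : mults n) : seq nat :=
  sort geq (flatten [seq nseq (f i) i.+1 | i <- enum 'I_n]).

Lemma mseq_is_intpart n (f : mults n) : is_intpart (mseq f).
Proof.
apply/andP; split; first by apply: sort_sorted => a b; exact: leq_total.
rewrite mem_sort; apply/flattenP => -[s /mapP[i _ ->]].
by rewrite mem_nseq eqE /= andbF.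
Qed.

Definition mpart n (f : mults n) : intpart := IntPart (mseq_is_intpart f).

Lemma count_mpart n (f : mults n) (i : 'I_n) : count_mem i.+1 (mpart f) = f i.
Proof.
rewrite /= /mseq count_sort count_flatten -map_comp sumnE big_map big_enum /=.
rewrite (bigD1 i) //= count_nseq /= eqxx mul1n big1 ?addn0 // => j ji.
by rewrite count_nseq /= eqSS (inj_eq val_inj) (negPf ji).
Qed.

Lemma nparts_mpart n (f : mults n) : nparts (mpart f) = msize f.
Proof.
rewrite /nparts /= /mseq size_sort size_flatten /shape -map_comp sumnE.
by rewrite big_map big_enum /=; apply: eq_bigr => i _; rewrite size_nseq.
Qed.

Lemma psum_mpart n (f : mults n) : psum (mpart f) = mweight f.
Proof.
rewrite /psum /= /mseq (perm_sumn (permEl (perm_sort _ _))) sumn_flatten.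
rewrite -map_comp sumnE big_map big_enum /=.
by apply: eq_bigr => i _; rewrite sumn_nseq mulnC.
Qed.

Lemma mpart_inj n : injective (@mpart n).
Proof.
move=> f g fg; apply/ffunP => i; apply: val_inj.
by rewrite /= -!count_mpart fg.
Qed.

Lemma mpart_mem n (f : mults n) k :
  k \in parts (mpart f) -> exists2 i : 'I_n, k = i.+1 & (0 < f i)%N.
Proof.
rewrite /= mem_sort => /flattenP[s /mapP[i _ ->]].
by rewrite mem_nseq => /andP[fi /eqP->]; exists i.
Qed.

Lemma mem_mpart n (f : mults n) (i : 'I_n) :
  (i.+1 \in parts (mpart f)) = (0 < f i)%N.
Proof. by rewrite -has_pred1 has_count count_mpart. Qed.

Lemma count_le_sumn (s : seq nat) k : (count_mem k s * k <= sumn s)%N.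
Proof.
elim: s => //= a s IHs; rewrite mulnDl leq_add //.
by case: eqP => [->|_]; rewrite ?mul1n.
Qed.

Lemma mpart_onto n (p : intpart) :
  (psum p <= n)%N -> exists f : mults n, p = mpart f.
Proof.
(* A multiplicity is bounded by the sum of the parts, so it fits in ['I_n.+1]. *)
move=> pn; have cn k : (count_mem k.+1 p < n.+1)%N.
  have := count_le_sumn p k.+1; rewrite -/(psum p); nia.
exists [ffun i : 'I_n => Ordinal (cn i)]; apply: val_inj => /=.
case: p pn cn => s sP pn cn; have /andP[sS s0] := sP; rewrite /= in pn cn *.
have geq_trans : transitive geq by move=> a b c /= ab ca; apply: leq_trans ab.
have geq_anti : antisymmetric geq.
  by move=> a b /= /andP[ab ba]; apply/eqP; rewrite eqn_leq ab ba.
set f := finfun _; have /andP[fS f0] := mseq_is_intpart f.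
(* Sorted sequences with the same multiplicities coincide, so it suffices to compare counts. *)
apply: (sorted_eq geq_trans geq_anti sS fS); apply/allP => k _ /=; apply/eqP.
case: k => [|k].
  by rewrite (count_memPn s0) (count_memPn f0).
have [kn|nk] := ltnP k n.
  transitivity (nat_of_ord (f (Ordinal kn))); first by rewrite ffunE.
  by rewrite -count_mpart.
have -> : count_mem k.+1 s = 0%N.
  have := count_le_sumn s k.+1; rewrite /psum /= in pn; nia.
apply/esym/count_memPn/negP => /mpart_mem[i [ki] _].
by have := ltn_ord i; rewrite -ki ltnNge nk.
Qed.

(** * Coefficients as finite sums over multiplicities *)

(** This trades the finitely supported sum for a big operator over a finite type; [h] only has to
    reach the elements of [A] of weight [n]. *)
Lemma genfun_reindex (T : choiceType) (I : finType) (h : I -> T) (A : set T)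
    (c : T -> int) (w : T -> nat) n (B : pred I) :
  injective h -> (forall i, B i <-> A (h i) /\ w (h i) = n) ->
  (forall t, A t -> w t = n -> exists i, t = h i) ->
  genfun A c w n = \sum_(i | B i) c (h i).
Proof.
move=> h_inj BP h_onto; rewrite /genfun -[RHS]big_filter.
rewrite -(big_map h xpredT c) [RHS]fsbig_seq; last first.
  by rewrite map_inj_uniq ?filter_uniq ?index_enum_uniq.
apply: eq_fsbigl; apply/seteqP; split => t /=.
  move=> [At wt]; have [i ti] := h_onto t At wt.
  by rewrite ti map_f // mem_filter mem_index_enum andbT; apply/BP; rewrite -ti.
by move=> /mapP[i]; rewrite mem_filter => /andP[/BP Bi _] ->.
Qed.

(** Expanding the product picks one exponent [j] per factor [i], that is, one multiplicity
    function. *)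
Lemma prod_family (R : comNzRingType) n (Q : 'I_n -> pred 'I_n.+1) (z : R) :
  \prod_(i < n) \sum_(j < n.+1 | Q i j) (z%:P * 'X^(i.+1)) ^+ j
  = \sum_(f in family Q) (z ^+ msize f)%:P * 'X^(mweight f).
Proof.
rewrite bigA_distr_big_dep; apply: eq_bigr => f _.
transitivity (\prod_i ((z ^+ f i)%:P * 'X^(f i * i.+1)) : {poly R}).
  by apply: eq_bigr => i _; rewrite exprMn rmorphXn -exprM mulnC.
by rewrite big_split /= -rmorph_prod -!prodrXr.
Qed.

Lemma coef_family (R : comNzRingType) n (B : pred (mults n)) (z : R) m :
  (\sum_(f | B f) (z ^+ msize f)%:P * 'X^(mweight f))`_m
  = \sum_(f | B f && (mweight f == m)) z ^+ msize f.
Proof.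
rewrite coef_sum big_mkcondr; apply: eq_bigr => f _.
by rewrite coefCM coefXn eq_sym; case: eqP; rewrite ?mulr1 ?mulr0.
Qed.

(** The weight [1 ^+ msize f] is the shape that [prod_family] gives at [z = 1]. *)
Lemma coef_family2 (R : comNzRingType) n (B C : pred (mults n)) (z : R) m :
  ((\sum_(f | B f) (1 ^+ msize f)%:P * 'X^(mweight f))
    * \sum_(g | C g) (z ^+ msize g)%:P * 'X^(mweight g))`_m
  = \sum_(fg | (B fg.1 && C fg.2) && (mweight fg.1 + mweight fg.2 == m)%N)
      z ^+ msize fg.2.
Proof.
rewrite big_distrlr /= pair_big /= coef_sum [RHS]big_mkcondr.
apply: eq_bigr => -[f g] _ /=.
rewrite expr1n mul1r mulrCA -exprD coefCM coefXn eq_sym.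
by case: eqP; rewrite ?mulr1 ?mulr0.
Qed.

Definition distinct_mults n : 'I_n -> pred 'I_n.+1 := fun _ j => (j <= 1)%N.
Definition regular3_mults n : 'I_n -> pred 'I_n.+1 :=
  fun i j => (3 %| i.+1)%N ==> (j == ord0).

Lemma euler_prod_family (R : comNzRingType) n (z : R) :
  euler_prod n 'X predT z%:P
  = \sum_(f in family (@distinct_mults n))
      ((- z) ^+ msize f)%:P * 'X^(mweight f).
Proof.
rewrite -prod_family; apply: eq_bigr => i _.
(* An index [i] forces [n] to be positive, so both multiplicities 0 and 1 lie in ['I_n.+1]. *)
case: n i => [[]//|n] i; rewrite big_mkcond /= !big_ord_recl /= big1 //.
by rewrite expr0 expr1 addr0 rmorphN mulNr.
Qed.

Lemma geom_prod_family (R : comNzRingType) n (z : R) :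
  geom_prod n 'X predT z%:P
  = \sum_(f : mults n) (z ^+ msize f)%:P * 'X^(mweight f).
Proof.
transitivity (\sum_(f in family (fun (_ : 'I_n) (_ : 'I_n.+1) => true))
    (z ^+ msize f)%:P * 'X^(mweight f)); first by rewrite -prod_family.
by apply: eq_bigl => f; apply/familyP.
Qed.

Lemma geom_prod_regular3_family (R : comNzRingType) n :
  geom_prod n 'X (fun k => ~~ (3 %| k)%N) (1 : {poly R})
  = \sum_(f in family (@regular3_mults n))
      (1 ^+ msize f)%:P * 'X^(mweight f).
Proof.
rewrite -prod_family /geom_prod big_mkcond; apply: eq_bigr => i _ /=.
rewrite /regular3_mults; case: (3 %| i.+1)%N => //=.
by rewrite big_pred1_eq expr0.
Qed.

(** Both sides are coefficients of ['X^n] in the two sides of [euler_omega], which applies in the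
    quotient by ['X^(n.+1)], where the class of ['X] is nilpotent. *)
Lemma coef_euler_omega (R : comNzRingType) n (w : R) : w ^+ 2 + w + 1 = 0 ->
  \sum_(f | (f \in family (@distinct_mults n)) && (mweight f == n))
    (- w) ^+ msize f
  = \sum_(fg : mults n * mults n | (fg.1 \in family (@regular3_mults n))
               && (mweight fg.1 + mweight fg.2 == n)%N)
      (w ^+ 2) ^+ msize fg.2.
Proof.
move=> w2; rewrite -coef_family -euler_prod_family.
under [RHS]eq_bigl => fg do rewrite -[_ \in _]andbT.
rewrite -(coef_family2 _ xpredT) -geom_prod_regular3_family -geom_prod_family.
apply: coef_eq_mod_Xn.
pose phi : {rmorphism {poly R} -> {poly %/ 'X^(n.+1)}} := in_qpoly 'X^(n.+1).
rewrite -!/(phi _).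
have phiX0 : (phi 'X) ^+ n.+1 = 0.
  rewrite -rmorphXn /=; apply: val_inj => /=.
  by rewrite mk_monic_Xn /= Pdiv.RingMonic.rmodpp // monicXn.
have phiw : (phi w%:P) ^+ 2 + phi w%:P + 1 = 0.
  by rewrite -rmorphXn -(rmorph1 phi) -!rmorphD -polyC_exp -polyC1 -!polyCD w2
    rmorph0.
rewrite (rmorphM phi) rmorph_euler_prod !rmorph_geom_prod rmorph1.
by rewrite polyC_exp rmorphXn; exact: euler_omega.
Qed.

(** * Membership conditions, sign weights and conclusion *)

Lemma uniq_mpart n (f : mults n) :
  uniq (mpart f) = (f \in family (@distinct_mults n)).
Proof.
apply/idP/familyP => [fU i | fD].
  by rewrite unfold_in /distinct_mults -count_mpart count_uniq_mem // leq_b1.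
apply: count_mem_uniq => k; have [|/count_memPn//] := boolP (k \in _).
move=> /[dup] kf /mpart_mem[i ki fi]; rewrite ki count_mpart; apply/eqP.
by rewrite eqn_leq fi andbT; apply: fD.
Qed.

Lemma P2_mpart n (f : mults n) :
  P2 (mpart f) <-> f \in family (@regular3_mults n).
Proof.
split=> [[_ f3] | /familyP f3].
  apply/familyP => i; rewrite unfold_in /regular3_mults; apply/implyP => i3.
  apply: contraLR i3 => fi; apply: f3; rewrite mem_mpart lt0n.
  by apply: contra fi => /eqP fi0; apply/eqP/val_inj.
split=> // k /mpart_mem[i -> fi]; apply/negP => i3.
have := f3 i; rewrite unfold_in /regular3_mults i3 /= => /eqP fi0.
by rewrite fi0 in fi.
Qed.

Lemma omega_cube (R : comNzRingType) (w : R) :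
  w ^+ 2 + w + 1 = 0 -> w ^+ 3 = 1.
Proof.
move=> w2; apply/eqP; rewrite -subr_eq0; apply/eqP.
by transitivity ((w - 1) * (w ^+ 2 + w + 1)); [ring | rewrite w2 mulr0].
Qed.

(** Up to sign the right side is [w ^+ (2 * k + 1) - w ^+ k]; the exponents agree modulo 3 exactly
    when [k] is 2 modulo 3. The factor [1 - w] avoids a division. *)
Lemma omega_weight_distinct (R : comNzRingType) (w : R) k :
  w ^+ 2 + w + 1 = 0 ->
  (1 - w) * (if (k %% 3 != 2)%N then (-1) ^+ (k + (k %% 3 == 0))%N else 0)%:~R
  = w * (- (w ^+ 2)) ^+ k - (- w) ^+ k.
Proof.
move=> w2; have w3 := omega_cube w2.
(* The sign [(-1) ^+ k] is split off, since only the powers of [w] may be reduced modulo 3. *)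
rewrite (exprNn w) (exprNn (w ^+ 2)) -exprM mulnC exprM -(expr_mod k w3).
have : (k %% 3 < 3)%N by rewrite ltn_mod.
case: (k %% 3)%N => [|[|[|//]]] _ /=;
  rewrite ?addn0 ?addn1 ?rmorphXn ?rmorphN1 ?exprS ?expr0 ?mulr1.
- by ring.
- transitivity ((-1) ^+ k * (w ^+ 3 - w)); last by ring.
  by rewrite w3; ring.
transitivity ((-1) ^+ k * (w ^+ 3 * w ^+ 2 - w ^+ 2)); last by ring.
by rewrite w3; ring.
Qed.

(** Here the exponents [k + 1] and [2 * k] agree modulo 3 exactly when [k] is 1 modulo 3. The form
    [(w ^+ 2) ^+ 2] is the one that [coef_euler_omega] yields at [w ^+ 2]. *)
Lemma omega_weight_all (R : comNzRingType) (w : R) k :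
  w ^+ 2 + w + 1 = 0 ->
  (1 - w) * (if (k %% 3 != 1)%N then (-1) ^+ (k %% 3 == 0)%N else 0)%:~R
  = w * ((w ^+ 2) ^+ 2) ^+ k - (w ^+ 2) ^+ k.
Proof.
move=> w2; have w3 := omega_cube w2.
have -> : (w ^+ 2) ^+ 2 = w by rewrite -exprM (exprS w 3) w3 mulr1.
rewrite -exprM mulnC exprM -(expr_mod k w3).
have : (k %% 3 < 3)%N by rewrite ltn_mod.
case: (k %% 3)%N => [|[|[|//]]] _ /=; rewrite ?expr0 ?expr1 ?rmorphN1.
- by ring.
- by ring.
transitivity (w ^+ 3 - w ^+ 3 * w); last by ring.
by rewrite w3; ring.
Qed.

Theorem theorem33 :
  genfun P1star (fun p => (-1) ^+ mu_star p) psum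
  = genfun (P2 `*` P3star)
      (fun pp : intpart * intpart => (-1) ^+ sigma_star pp.2)
      (fun pp : intpart * intpart => (psum pp.1 + psum pp.2)%N).
Proof.
apply/funext => n.
have [w prim] := C_prim_root_exists (isT : (0 < 3)%N).
have w1 : 1 - w != 0.
  by rewrite subr_eq0 eq_sym; have := eq_prim_root_expr prim 1 0 => /= ->.
have w2 : w ^+ 2 + w + 1 = 0.
  apply: (mulfI w1); rewrite mulr0; transitivity (1 - w ^+ 3); first by ring.
  by rewrite prim_expr_order ?subrr.
have w4 : (w ^+ 2) ^+ 2 + w ^+ 2 + 1 = 0.
  by rewrite -exprM (exprS w 3) (omega_cube w2) mulr1 -[RHS]w2; ring.
apply: (@intr_inj algC); apply: (mulfI w1).
rewrite (@genfun_reindex _ _ (@mpart n) _ _ _ _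
  (fun f => (f \in family (@distinct_mults n)) && (mweight f == n)
            && (msize f %% 3 != 2)%N)); first last.
- by move=> p _ pn; apply: mpart_onto; rewrite pn.
- move=> f; rewrite psum_mpart /P1star /Dset /= uniq_mpart nparts_mpart.
  by split=> [/andP[/andP[-> /eqP->] /eqP]|[[-> /eqP->] ->]] //; rewrite eqxx.
- exact: mpart_inj.
rewrite (@genfun_reindex _ _ (fun fg => (@mpart n fg.1, @mpart n fg.2)) _ _ _ _
  (fun fg => (fg.1 \in family (@regular3_mults n))
     && (mweight fg.1 + mweight fg.2 == n)%N
     && (msize fg.2 %% 3 != 1)%N)); first last.
- move=> [p1 p2] _ /= pn.
  have [|f ->] := @mpart_onto n p1; first by rewrite -pn leq_addr.
  have [|g ->] := @mpart_onto n p2; first by rewrite -pn leq_addl.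
  by exists (f, g).
- move=> [f g]; rewrite /= !psum_mpart /P3star /= nparts_mpart.
  split=> [/andP[/andP[/P2_mpart f3 /eqP->] /eqP] //|].
  move=> [[/P2_mpart-> [_ /eqP->]] ->].
  by rewrite eqxx.
- move=> [f g] [f' g'] /= E; congr (_, _); apply: mpart_inj.
    exact: (congr1 fst E).
  exact: (congr1 snd E).
(* The condition modulo 3 moves into the summand, as the weight lemmas expect. *)
rewrite !rmorph_sum !mulr_sumr big_mkcondr [RHS]big_mkcondr /=.
transitivity (\sum_(f | (f \in family (@distinct_mults n)) && (mweight f == n))
    (w * (- (w ^+ 2)) ^+ msize f - (- w) ^+ msize f)).
  apply: eq_bigr => f _; rewrite -omega_weight_distinct //.
  rewrite /mu_star /sigma_star nparts_mpart.
  by case: ifP => _; [case: (msize f %% 3)%N | rewrite mulr0].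
(* The product identity is used at both [w ^+ 2] and [w], with the coefficients [w] and [-1]
   unchanged. *)
rewrite sumrB -mulr_sumr !coef_euler_omega // mulr_sumr -sumrB.
apply: eq_bigr => -[f g] _ /=; rewrite -omega_weight_all //.
rewrite /sigma_star nparts_mpart.
by case: ifP => _; [case: (msize g %% 3)%N | rewrite mulr0].
Qed.
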